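(* For any integer $n \geq 1$, $|\mathcal{F}(n; 321)| = C_{n-1}$, where $C_{m} = \frac{1}{m+1}\binom{2m}{m}$ is the $m$-th Catalan number (with $C_{0} = 1$).
   Context: For a positive integer $n$, $[n]=\{1,\dots,n\}$, and a permutation $\sigma$ of $[n]$ is written as the word $\sigma(1)\sigma(2)\cdots\sigma(n)$. A run of $\sigma$ is a maximal block of consecutive positions on which $\sigma$ is increasing, so $\sigma$ is uniquely the concatenation of its runs; the starting point of a run is its first entry. A flattened partition over $[n]$ is a permutation of $[n]$ whose runs, read from left to right, have increasing starting points. A permutation contains a pattern $\tau$ if it has a (not necessarily contiguous) subsequence order-isomorphic to $\tau$; otherwise it is $\tau$-avoiding. $\mathcal{F}(n;\tau)$ is the set of $\tau$-avoiding flattened partitions over $[n]$. *)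

(* Defs.v *)
From mathcomp Require Import all_boot all_fingroup.

Set Implicit Arguments.
Unset Strict Implicit.
Unset Printing Implicit Defensive.

(* Permutations of [n] are elements of 'S_n: positions and values are both
   shifted down by one, to {0, ..., n-1}, and s stands for the word
   s 0, s 1, ..., s (n-1).  Pairs i, j of positions with i <= j represent the
   block of consecutive positions i, i+1, ..., j. *)

Definition increasing_on n (s : 'S_n) (i j : 'I_n) : bool :=
  [forall x : 'I_n, forall y : 'I_n, [&& i <= x, x < y & y <= j] ==> (s x < s y)].

(* The last conjunct is maximality among the blocks on which s increases. *)
Definition is_run n (s : 'S_n) (i j : 'I_n) : bool :=
  [&& i <= j, increasing_on s i j &
      [forall i' : 'I_n, forall j' : 'I_n,
         [&& i' <= i, j <= j' & increasing_on s i' j']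
           ==> (i' == i) && (j' == j)]].

Definition flattened n (s : 'S_n) : bool :=
  [forall i : 'I_n, forall j : 'I_n, forall i' : 'I_n, forall j' : 'I_n,
     [&& is_run s i j, is_run s i' j' & i < i'] ==> (s i < s i')].

(* f lists, in increasing order, the positions of an occurrence of t in s. *)
Definition contains n k (s : 'S_n) (t : 'S_k) : bool :=
  [exists f : {ffun 'I_k -> 'I_n},
     [forall a : 'I_k, forall b : 'I_k, (a < b) ==> (f a < f b)] &&
     [forall a : 'I_k, forall b : 'I_k, (s (f a) < s (f b)) == (t a < t b)]].

Definition flattened_avoiding n k (t : 'S_k) : {set 'S_n} :=
  [set s | flattened s & ~~ contains s t].

Definition pattern321 : 'S_3 := perm (@rev_ord_inj 3).

(* The division is exact, see mul_catalan. *)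
Definition catalan (m : nat) : nat := 'C(2 * m, m) %/ m.+1.

Lemma mul_catalan m : m.+1 * catalan m = 'C(2 * m, m).
Proof.
rewrite /catalan mulnC divnK //.
have H : m.+1 * 'C(2 * m, m.+1) = m * 'C(2 * m, m).
  by rewrite mul_bin_left mul2n -addnn addnK.
have co : coprime m.+1 m by rewrite coprimeSn.
by rewrite -(Gauss_dvdr _ co) -H dvdn_mulr.
Qed.

(* Main.v *)
Require Import Defs.
From mathcomp Require Import all_boot all_fingroup.
From mathcomp Require Import zify.

(** Every run but the first starts right after a descent.  In a 321-avoiding
    permutation two descent bottoms can never appear in decreasing order, since
    the entry before the first of them would complete a 321.  So the only
    constraint imposed by flattening concerns the first run: its starting point
    must lie below all the other ones, which means that the first entry is the
    minimum ([flattened_avoids321]).  A leading minimum takes part in no 321,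
    and removing it identifies the objects to count with all 321-avoiding
    permutations of one letter less ([card_flattened_avoiding]).

    These are counted with a generating tree.  A 321-avoiding permutation of n+1
    letters arises in a unique way by inserting a new maximum in one of n, and
    the insertion is allowed exactly where the remaining entries increase
    ([avoids321_lift_max]).  If s has k such sites, inserting in the last one
    gives a permutation with k+1 sites, while inserting in front of j > 0
    entries gives one with j+1 sites, j = 1, ..., k-1 ([sites_lift_max]).  The
    children of a node labelled k are thus labelled 2, ..., k+1: this is the
    Catalan tree.  The number [descendants r k] of nodes r levels below a label k
    is a ballot number, the difference of two neighbouring binomial coefficients
    ([descendants_ballot]), and the root, the empty permutation with its single
    site, has the Catalan numbers as its level sizes. *)

Set Implicit Arguments.
Unset Strict Implicit.
Unset Printing Implicit Defensive.

(** * Avoidance of 321 *)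

Definition avoids321 n (s : 'S_n) : bool :=
  [forall i : 'I_n, forall j : 'I_n, forall k : 'I_n,
     ~~ [&& i < j, j < k, s k < s j & s j < s i]].

Lemma avoids321P n (s : 'S_n) :
  reflect (forall i j k : 'I_n, i < j -> j < k -> s k < s j -> s j < s i -> False)
          (avoids321 s).
Proof.
apply: (iffP forallP) => [H i j k ij jk kj ji|H i].
  by move/(_ i)/forallP/(_ j)/forallP/(_ k): H; rewrite ij jk kj ji.
apply/forallP=> j; apply/forallP=> k; apply/negP=> /and4P[ij jk kj ji].
exact: H ij jk kj ji.
Qed.

Lemma contains_pattern321 n (s : 'S_n) :
  contains s pattern321 = ~~ avoids321 s.
Proof.
pose o0 : 'I_3 := @Ordinal 3 0 isT.
pose o1 : 'I_3 := @Ordinal 3 1 isT.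
pose o2 : 'I_3 := @Ordinal 3 2 isT.
apply/idP/idP.
  case/existsP=> f /andP[/forallP posf /forallP valf].
  have pos (a b : 'I_3) : a < b -> f a < f b by move: (posf a) => /forallP/(_ b)/implyP.
  have val (a b : 'I_3) : b < a -> s (f a) < s (f b).
    move=> ba; move: (valf a) => /forallP/(_ b)/eqP->.
    by rewrite !permE /=; case: a b ba => [a ha] [b hb] /=; lia.
  apply/negP=> /avoids321P/(_ (f o0) (f o1) (f o2)).
  by apply; [apply: pos | apply: pos | apply: val | apply: val].
apply: contraR => noc; apply/avoids321P=> i j k ij jk kj ji.
case/negP: noc; apply/existsP.
exists [ffun a : 'I_3 => if val a == 0 then i else if val a == 1 then j else k].
apply/andP; split; apply/forallP=> -[a ha]; apply/forallP=> -[b hb];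
  rewrite !ffunE ?permE /=.
  by case: a b ha hb => [|[|[|a]]] [|[|[|b]]] //= *; lia.
by case: a b ha hb => [|[|[|a]]] [|[|[|b]]] //= *; lia.
Qed.

(** * Runs and descents *)

Lemma increasing_onP n (s : 'S_n) (i j : 'I_n) :
  reflect (forall x y : 'I_n, i <= x -> x < y -> y <= j -> s x < s y)
          (increasing_on s i j).
Proof.
apply: (iffP forallP) => [H x y ix xy yj|H x].
  by move/(_ x)/forallP/(_ y): H; rewrite ix xy yj.
by apply/forallP=> y; apply/implyP=> /and3P[]; apply: H.
Qed.

Lemma increasing_on_cons n (s : 'S_n) (h i j : 'I_n) :
  i = h.+1 :> nat -> s h < s i -> increasing_on s i j -> increasing_on s h j.
Proof.
move=> ih hi /increasing_onP H; apply/increasing_onP=> x y hx xy yj.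
have incr_i (z : 'I_n) : i < z -> z <= j -> s i < s z by apply: H.
have [xh|xh] := eqVneq x h; last first.
  by apply: H => //; move: xh; rewrite -val_eqE /=; lia.
rewrite xh; have [->//|yi] := eqVneq y i.
apply: (ltn_trans hi); apply: incr_i => //.
by move: yi; rewrite -val_eqE /=; rewrite xh in xy; lia.
Qed.

(** A block can be extended to the left unless it is preceded by a descent; and
    a block of one entry can always be extended to the right up to a maximal
    one, so runs start exactly at the first position and after descents. *)
Lemma run_startP n (s : 'S_n) (i : 'I_n) :
  (exists j, is_run s i j) <->
  (forall h : 'I_n, i = h.+1 :> nat -> s i < s h).
Proof.
split=> [[j /and3P[ij incr /forallP max]] h ih|start].
  rewrite ltnNge leq_eqVlt; apply/negP=> /orP[/eqP/val_inj/perm_inj hi|hi].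
    by rewrite hi in ih; lia.
  have := increasing_on_cons ih hi incr.
  move/(_ h)/forallP/(_ j): max => /implyP max incr'.
  have /andP[/eqP hi' _] : (h == i) && (j == j) by apply: max; rewrite incr' leqnn andbT; lia.
  by rewrite hi' in ih; lia.
have incri : increasing_on s i i by apply/increasing_onP=> x y; lia.
case: (@arg_maxnP _ i [pred j : 'I_n | (i <= j) && increasing_on s i j] val).
  by rewrite /= leqnn.
move=> j /= /andP[ij incr] max; exists j; apply/and3P; split=> //.
apply/forallP=> i'; apply/forallP=> j'; apply/implyP=> /and3P[i'i jj' incr'].
have ei : i' = i.
  apply/val_inj/eqP; rewrite eqn_leq i'i leqNgt /=; apply/negP=> lti.
  have hlt : i.-1 < n by have := ltn_ord i; lia.
  have ih : i = (Ordinal hlt).+1 :> nat by rewrite /=; lia.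
  have := start _ ih; rewrite ltnNge ltnW //.
  by move/increasing_onP: incr'; apply; rewrite /=; lia.
rewrite ei eqxx /=; apply/eqP/val_inj/eqP; rewrite eqn_leq jj' andbT.
by apply: max; rewrite -{2}ei incr' andbT; lia.
Qed.

(** The minimum 0, if not in first position, starts a run whose starting point
    is below that of the first run.  Conversely two later runs with decreasing
    starting points give a 321 with the entry preceding the first of them. *)
Lemma flattened_avoids321 n (s : 'S_n.+1) :
  avoids321 s -> flattened s = (s ord0 == ord0).
Proof.
move=> /avoids321P av; apply/idP/eqP => [flat|s0].
  have [//|pos] := eqVneq (s ord0) ord0.
  pose p := (s^-1)%g ord0; have sp : s p = ord0 by rewrite permKV.
  have p0 : 0 < p.
    rewrite lt0n; apply: contra pos => /eqP p0.
    by rewrite -[X in s X](_ : p = ord0) ?sp //; apply: val_inj.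
  (* Nothing precedes position 0, and the entry before p exceeds s p = 0. *)
  have [j0 run0] : exists j, is_run s ord0 j by apply/run_startP.
  have [jp runp] : exists j, is_run s p j.
    apply/run_startP=> h ph; rewrite sp /= lt0n; apply/negP=> /eqP sh.
    have /perm_inj hp : s h = s p by rewrite sp; apply: val_inj.
    by rewrite hp in ph; lia.
  move: flat => /forallP/(_ ord0)/forallP/(_ j0)/forallP/(_ p)/forallP/(_ jp).
  by rewrite run0 runp p0 sp.
apply/forallP=> i; apply/forallP=> j; apply/forallP=> i'; apply/forallP=> j'.
apply/implyP=> /and3P[runi runi' ii'].
have sne : s i <> s i' :> nat.
  by move/val_inj/perm_inj=> e; rewrite e ltnn in ii'.
have [i0|ipos] := posnP i.
  have e : i = ord0 by apply: val_inj.
  by rewrite e s0 in sne *; move: sne => /=; lia.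
have hlt : i.-1 < n.+1 by have := ltn_ord i; lia.
have ih : i = (Ordinal hlt).+1 :> nat by rewrite /=; lia.
have top : s i < s (Ordinal hlt).
  by apply: (proj1 (run_startP s i)) ih; exists j.
rewrite ltnNge; apply/negP=> le.
by apply: (av (Ordinal hlt) i i') => //; rewrite /= in ih *; lia.
Qed.

(** * Inserting an entry *)

Lemma ltn_lift n (i : 'I_n) (a b : 'I_n.-1) : (lift i a < lift i b) = (a < b).
Proof. by rewrite !ltnNge leq_bump2. Qed.

Lemma lift_perm_inj n (i j : 'I_n.+1) : injective (@lift_perm n i j).
Proof.
move=> s t e; apply/permP=> k; apply: (@lift_inj _ j).
by rewrite -!(lift_perm_lift i) e.
Qed.

Lemma lift_perm_surj n (i j : 'I_n.+1) (s : 'S_n.+1) :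
  s i = j -> exists t, lift_perm i j t = s.
Proof.
move=> sij.
pose f k := odflt k (unlift j (s (lift i k))).
have fE k : lift j (f k) = s (lift i k).
  rewrite /f; case: unliftP => [k' ->//|].
  by rewrite -sij => /perm_inj/eqP; rewrite eq_sym (negPf (neq_lift _ _)).
have finj : injective f.
  by move=> k l e; apply/(@lift_inj _ i)/(@perm_inj _ s); rewrite -!fE e.
exists (perm finj); apply/permP=> k.
case: (unliftP i k) => [k' ->|->]; last by rewrite lift_perm_id.
by rewrite lift_perm_lift permE fE.
Qed.

(** Permutations sending i to j are those obtained by inserting the value j at
    position i, each in one way. *)
Lemma big_lift_perm n (i j : 'I_n.+1) (P : pred 'S_n.+1) (F : 'S_n.+1 -> nat) :
  \sum_(s : 'S_n.+1 | (s i == j) && P s) F s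
  = \sum_(t : 'S_n | P (lift_perm i j t)) F (lift_perm i j t).
Proof.
have e : [set s : 'S_n.+1 | s i == j] = lift_perm i j @: setT.
  apply/setP=> s; rewrite inE; apply/eqP/imsetP => [/lift_perm_surj[t <-]|[t _ ->]].
    by exists t.
  exact: lift_perm_id.
transitivity (\sum_(s in [set s : 'S_n.+1 | s i == j] | P s) F s).
  by apply: eq_bigl => s; rewrite inE.
rewrite e big_imset_cond /=; first by apply: eq_bigl => t; rewrite inE.
by move=> s t _ _; apply: lift_perm_inj.
Qed.

(** A minimum in first position could only be the first, hence the largest,
    entry of a 321. *)
Lemma avoids321_lift0 n (s : 'S_n) :
  avoids321 (lift_perm ord0 ord0 s) = avoids321 s.
Proof.
apply/avoids321P/avoids321P=> av i j k.
  move=> ij jk kj ji.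
  by apply: (av (lift ord0 i) (lift ord0 j) (lift ord0 k));
    rewrite ?lift_perm_lift ltn_lift.
case: (unliftP ord0 i) => [{}i ->|->]; last by rewrite lift_perm_id.
case: (unliftP ord0 j) => [{}j ->|-> //].
case: (unliftP ord0 k) => [{}k ->|-> //].
rewrite !lift_perm_lift !ltn_lift; exact: av.
Qed.

Lemma card_flattened_avoiding n :
  #|flattened_avoiding n.+1 pattern321| = #|[set s : 'S_n | avoids321 s]|.
Proof.
rewrite -!sum1_card.
transitivity (\sum_(s : 'S_n.+1 | (s ord0 == ord0) && avoids321 s) 1).
  apply: eq_bigl => s; rewrite inE contains_pattern321 negbK andbC [RHS]andbC.
  by case: (boolP (avoids321 s)) => //= /flattened_avoids321->.
rewrite big_lift_perm; apply: eq_bigl => s.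
by rewrite inE avoids321_lift0.
Qed.

(** * Sites for a new maximum *)

(** The cut-off p is a natural number since insertion may also take place at the
    very end, where p = n is not a position of s. *)
Definition increasing_from n (s : 'S_n) (p : nat) : bool :=
  [forall x : 'I_n, forall y : 'I_n, (p <= x < y) ==> (s x < s y)].

Lemma increasing_fromP n (s : 'S_n) p :
  reflect (forall x y : 'I_n, p <= x -> x < y -> s x < s y)
          (increasing_from s p).
Proof.
apply: (iffP forallP) => [H x y px xy|H x].
  by move/(_ x)/forallP/(_ y): H; rewrite px xy.
by apply/forallP=> y; apply/implyP=> /andP[]; apply: H.
Qed.

(** By [avoids321_lift_max] below, this is the number of places where a new
    maximum can be inserted without creating a 321. *)
Definition sites n (s : 'S_n) : nat := \sum_(p < n.+1) increasing_from s p.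

(** A maximum can only play the part of the 3, which happens as soon as it is
    followed by a descending pair. *)
Lemma avoids321_lift_max n (i : 'I_n.+1) (s : 'S_n) :
  avoids321 (lift_perm i ord_max s) = avoids321 s && increasing_from s i.
Proof.
apply/avoids321P/andP => [av|[/avoids321P av /increasing_fromP incr] a b c].
  split; [apply/avoids321P=> a b c ab bc cb ba|apply/increasing_fromP=> x y ix xy].
    by apply: (av (lift i a) (lift i b) (lift i c));
      rewrite ?lift_perm_lift ltn_lift.
  rewrite ltnNge leq_eqVlt; apply/negP=> /orP[/eqP/val_inj/perm_inj e|yx].
    by rewrite e ltnn in xy.
  apply: (av i (lift i x) (lift i y)); rewrite ?lift_perm_id ?lift_perm_lift ?ltn_lift //.
    by rewrite /= /bump ix; lia.
  by rewrite lift_max /=.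
have topE k : (lift_perm i ord_max s i < lift_perm i ord_max s k) = false.
  by rewrite lift_perm_id /= ltnNge -ltnS ltn_ord.
case: (unliftP i b) => [{}b ->|->]; last by rewrite topE.
case: (unliftP i c) => [{}c ->|->]; last by rewrite topE.
case: (unliftP i a) => [{}a ->|->]; rewrite !lift_perm_lift !ltn_lift.
  exact: av.
move=> ib bc; rewrite ltnNge ltnW //.
by apply: incr => //; move: ib; rewrite /= /bump; lia.
Qed.

Lemma increasing_from_last n (s : 'S_n) p : n <= p.+1 -> increasing_from s p.
Proof.
move=> np; apply/increasing_fromP=> x y px xy.
by have := ltn_ord y; lia.
Qed.

Lemma increasing_from_leq n (s : 'S_n) p q :
  p <= q -> increasing_from s p -> increasing_from s q.
Proof.
move=> pq /increasing_fromP H; apply/increasing_fromP=> x y qx.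
by apply: H; apply: leq_trans qx.
Qed.

(** An up-closed property of the numbers below N holds on a final segment, whose
    beginning is then determined by its size. *)
Lemma sum_upclosed (P : pred nat) N :
  (forall p, P p -> P p.+1) ->
  forall p, p < N -> P p = (N - \sum_(q < N) P q <= p).
Proof.
move=> up; have mono p q : p <= q -> P p -> P q.
  by move=> pq; rewrite -(subnKC pq); elim: (q - p) => [|d IH];
    rewrite ?addn0 ?addnS // => /IH/up.
elim: N => [//|N IH] p; rewrite big_ord_recr /= ltnS leq_eqVlt => /orP[/eqP->|pN].
  have [PN|nPN] := boolP (P N); first by lia.
  rewrite big1 ?addn0 ?subn0 ?ltnn // => q _.
  by apply/eqP; rewrite eqb0; apply: contra nPN; apply: mono; apply: ltnW.
rewrite (IH _ pN).
have [PN|nPN] := boolP (P N); first by rewrite addn1 subSS.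
rewrite big1 ?addn0 ?subn0; first by lia.
move=> q _; apply/eqP; rewrite eqb0; apply: contra nPN; apply: mono.
exact: ltnW.
Qed.

Lemma increasing_from_sites n (s : 'S_n) p :
  p <= n -> increasing_from s p = (n.+1 - sites s <= p).
Proof.
move=> pn; apply: (@sum_upclosed (increasing_from s) n.+1 _ p pn) => q; exact: increasing_from_leq.
Qed.

Lemma sites_gt0 n (s : 'S_n) : 0 < sites s.
Proof. by rewrite /sites big_ord_recr /= increasing_from_last ?addn1. Qed.

Lemma sites_leq n (s : 'S_n) : sites s <= n.+1.
Proof.
rewrite -[n.+1]card_ord -sum1_card; apply: leq_sum => p _; exact: leq_b1.
Qed.

(** A maximum inserted before the end is followed by a smaller entry, so an
    increasing tail must start after it; beyond it, s was already increasing. *)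
Lemma increasing_from_lift_max n (i : 'I_n.+1) (s : 'S_n) p :
  increasing_from s i -> i < n ->
  increasing_from (lift_perm i ord_max s) p = (i < p).
Proof.
move=> /increasing_fromP incr ltin; apply/increasing_fromP/idP => [H|ip x y px xy].
  rewrite ltnNge; apply/negP=> pi.
  have := H i (lift i (Ordinal ltin)) pi.
  rewrite lift_perm_id lift_perm_lift lift_max /= /bump leqnn add1n ltnSn => /(_ isT).
  by have := ltn_ord (s (Ordinal ltin)); lia.
case: (unliftP i x) => [x' e|e]; last by rewrite e in px; lia.
case: (unliftP i y) => [y' e'|e']; last by rewrite e' in xy; lia.
subst x y; rewrite !lift_perm_lift !lift_max.
by apply: incr; rewrite ltn_lift // in xy; move: px; rewrite /= /bump; lia.
Qed.

Lemma increasing_from_lift_last n (s : 'S_n) p :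
  p <= n ->
  increasing_from (lift_perm ord_max ord_max s) p = increasing_from s p.
Proof.
move=> pn; apply/increasing_fromP/increasing_fromP => H x y.
  by have := H (lift ord_max x) (lift ord_max y);
    rewrite !lift_perm_lift !lift_max.
case: (unliftP ord_max x) => [{}x ->|->]; last by have := ltn_ord y => /=; lia.
case: (unliftP ord_max y) => [{}y ->|->]; rewrite !lift_perm_lift ?lift_perm_id !lift_max.
  exact: H.
by have := ltn_ord (s x).
Qed.

(** The last site leaves the old sites untouched and adds the new end; any other
    one destroys all sites up to position i. *)
Lemma sites_lift_max n (i : 'I_n.+1) (s : 'S_n) :
  increasing_from s i ->
  sites (lift_perm i ord_max s) = if i == n :> nat then (sites s).+1 else n.+1 - i.
Proof.
move=> incr; case: eqP => [e|ni].
  have -> : i = ord_max by apply: val_inj.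
  rewrite /sites big_ord_recr /= increasing_from_last // addn1; congr _.+1.
  by apply: eq_bigr => p _; rewrite increasing_from_lift_last // -ltnS.
have ltin : i < n by have := ltn_ord i; lia.
have up : forall p, i < p -> i < p.+1 by move=> p; apply: leqW.
rewrite /sites (eq_bigr (fun p : 'I_n.+2 => nat_of_bool (i < p))); last first.
  by move=> p _; rewrite increasing_from_lift_max.
have lt1 : i < n.+2 by lia.
have lt2 : i.+1 < n.+2 by lia.
(* The threshold is i + 1: the property fails at i and holds at i + 1. *)
have := @sum_upclosed (leq i.+1) _ up _ lt1.
have := @sum_upclosed (leq i.+1) _ up _ lt2.
by rewrite /= ltnn ltnSn; lia.
Qed.

(** * The Catalan tree *)

(** The number of nodes r levels below a node labelled k, in the tree where the
    children of a label k are labelled 2, ..., k+1. *)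
Fixpoint descendants (r k : nat) : nat :=
  if r is r'.+1 then \sum_(2 <= j < k.+2) descendants r' j else 1.

Lemma descendantsS r k :
  descendants r.+1 k.+1 = descendants r.+1 k + descendants r k.+2.
Proof. by rewrite /= big_nat_recr. Qed.

(** Both sides obey Pascal's rule, by [descendantsS] on the left.  Starting the
    induction at the unreachable label k = 0, which has no children, makes the
    base case the symmetry of the middle binomial coefficients. *)
Lemma descendants_ballot r k :
  descendants r.+1 k + 'C((2 * r + k).+1, r) = 'C((2 * r + k).+1, r.+1).
Proof.
elim: r k => [|r IHr] k.
  by rewrite /= sum_nat_const_nat muln1 bin0 bin1; lia.
elim: k => [|k IHk].
  have /= := mul_bin_left (2 * r.+1).+1 r.+1.
  rewrite /descendants -/descendants big_geq // addn0 add0n.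
  have -> : (2 * r.+1).+1 - r.+1 = r.+2 by lia.
  by move/eqP; rewrite eqn_pmul2l // => /eqP.
have := IHr k.+2; rewrite (descendantsS r.+1 k).
have -> : 2 * r + k.+2 = 2 * r.+1 + k by lia.
by rewrite addnS !(binS (2 * r.+1 + k).+1); lia.
Qed.

Lemma descendants1 m : descendants m 1 = catalan m.
Proof.
case: m => [//|m]; apply/eqP; rewrite -(eqn_pmul2l (ltn0Sn m.+1)) mul_catalan.
have := descendants_ballot m 1; have := mul_bin_left (2 * m.+1) m.
have -> : 2 * m.+1 - m = m.+2 by lia.
have -> : (2 * m + 1).+1 = 2 * m.+1 by lia.
nia.
Qed.

(** The sites are the i with n+1-k <= i <= n: the last one yields the label k+1,
    and the others the labels n+1-i, that is 2, ..., k. *)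
Lemma sum_children n (s : 'S_n) r :
  \sum_(i < n.+1 | increasing_from s i)
     descendants r (sites (lift_perm i ord_max s))
  = descendants r.+1 (sites s).
Proof.
have k0 := sites_gt0 s; have kn := sites_leq s; set k := sites s in k0 kn *.
pose D i := descendants r (if i == n then k.+1 else n.+1 - i).
transitivity (\sum_(i < n.+1 | n.+1 - k <= i) D i).
  apply: eq_big => [i|i incr]; first by rewrite increasing_from_sites // -ltnS.
  by rewrite sites_lift_max // /D -/k; case: ifP.
rewrite -(big_mkord (fun i => n.+1 - k <= i) D) big_mkcond big_nat_recr //=.
rewrite -big_mkcond /D eqxx ifT; last by lia.
rewrite big_nat_recr //=; congr (_ + _).
(* Reindex the remaining children by j = n + 1 - i. *)
rewrite [RHS](big_nat_widen _ _ n.+2) // -[2 in RHS]add0n big_addn [RHS]big_nat_rev /=.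
have -> : n.+2 - 2 = n by lia.
rewrite big_nat_cond [RHS]big_nat_cond; apply: eq_big => [i|i].
  by lia.
by move=> /andP[/andP[_ ltin] _]; rewrite ifF; [congr descendants|]; lia.
Qed.

(** Group the permutations of the next generation by the position of their
    maximum, and remove it. *)
Lemma sum_generation n r :
  \sum_(s : 'S_n.+1 | avoids321 s) descendants r (sites s)
  = \sum_(s : 'S_n | avoids321 s) descendants r.+1 (sites s).
Proof.
rewrite (partition_big (fun s : 'S_n.+1 => (s^-1)%g ord_max) predT) //=.
transitivity (\sum_(i < n.+1) \sum_(s : 'S_n | avoids321 s && increasing_from s i)
                 descendants r (sites (lift_perm i ord_max s))).
  apply: eq_bigr => i _; rewrite -(eq_bigl _ _ (avoids321_lift_max i)).
  rewrite -(big_lift_perm i ord_max (@avoids321 n.+1) (fun s => descendants r (sites s))); apply: eq_bigl => s; rewrite andbC; congr (_ && _).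
  by apply/eqP/eqP => [<-|<-]; rewrite ?permK ?permKV.
rewrite (exchange_big_dep (fun s => avoids321 s)) /=; last by move=> i s _ /andP[].
apply: eq_bigr => s av; rewrite -/(descendants r.+1 (sites s)) -sum_children.
by apply: eq_bigl => i; rewrite av.
Qed.

(** Descending n levels from the root and then r further ones reaches level
    n + r; for r = 0 the sum just counts 321-avoiding permutations. *)
Lemma sum_avoids321_descendants n r :
  \sum_(s : 'S_n | avoids321 s) descendants r (sites s) = catalan (n + r).
Proof.
elim: n r => [|n IHn] r; last by rewrite sum_generation IHn addnS.
rewrite -descendants1 (big_pred1 1%g) => [|s]; last first.
  rewrite /= [s](_ : _ = 1%g) ?eqxx; last by apply/permP=> -[].
  by apply/avoids321P=> -[].
by rewrite (_ : sites _ = 1) ?add0n //; apply/eqP; rewrite eqn_leq sites_leq sites_gt0.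
Qed.

Theorem theorem2p13 (n : nat) (hn : 1 <= n) :
  #|flattened_avoiding n pattern321| = catalan n.-1.
Proof.
case: n hn => [//|n] _; rewrite card_flattened_avoiding -sum1_card /=.
rewrite -[n in RHS]addn0 -sum_avoids321_descendants.
by apply: eq_bigl => s; rewrite inE.
Qed.
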